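(* Let $\mathcal H,\mathcal G$, $L$, $A$, $B$, $C$, $\beta$, $\mathbf Z$ be as in the Problem described in the context (the case $D=0$) and let the Assumption (i)–(v) of the context hold, with constants $\mu_A,\mu_B,\rho_A,\rho_B,\nu_A,\nu_B$ and sets $\Omega_A,\Omega_B$. Let $(\tau,\sigma)\in\Omega_A\times\Omega_B$, let $\theta\in\,]0,2[$, and let $\hat\rho\le0$ be the constant defined in the context. Assume that $$\sqrt{\sigma\tau}\,\|L\|<\frac{\beta+\hat\rho}{\beta}$$ and $$-\left(1+2\beta\sigma\|L\|^2(2-\theta)\right)\tau^2-2\hat\rho\sqrt\sigma\|L\|\left(2\beta\sigma\|L\|^2+\theta\right)\tau^{3/2}+2\left(\beta(2-\theta)-\hat\rho(2\beta\sigma\|L\|^2+\theta)\right)\tau+4\beta\hat\rho\sqrt\sigma\|L\|\tau^{1/2}+4\beta\hat\rho>0.$$ Let $(z_0,v_0)\in\mathcal H\times\mathcal G$ and let $(z_n,v_n)_{n\ge1}$ be generated by $$(\forall n\in\mathbb N)\quad\left\lfloor\begin{aligned}&p_{n+1}=J_{\tau A}(z_n-\tau(Cz_n+L^*v_n))\\&q_{n+1}=J_{\sigma B^{-1}}(v_n+\sigma L(2p_{n+1}-z_n))\\&(z_{n+1},v_{n+1})=(1-\theta)(z_n,v_n)+\theta(p_{n+1},q_{n+1}).\end{aligned}\right.$$ Then: (i) $(z_n,v_n)_{n\in\mathbb N}$ converges weakly to a point of $\mathbf Z$; (ii) if $\nu_A>0$ and $\nu_B>0$, then $(z_n,v_n)_{n\in\mathbb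 N}$ converges R-linearly to the unique point of $\mathbf Z$.
   Context: Problem (with $D=0$). $\mathcal H,\mathcal G$ are real Hilbert spaces, $L:\mathcal H\to\mathcal G$ is bounded linear with adjoint $L^*$, $A:\mathcal H\to2^{\mathcal H}$ and $B:\mathcal G\to2^{\mathcal G}$ are set-valued, $C:\mathcal H\to\mathcal H$ is $\beta$-cocoercive ($\langle x-y,Cx-Cy\rangle\ge\beta\|Cx-Cy\|^2$) with $\beta>0$. The solution set $\mathbf Z$ is the set of $(x,u)\in\mathcal H\times\mathcal G$ with $0\in(A+C)x+L^*u$ and $u\in BLx$; it is assumed nonempty. Semimonotonicity. For bounded self-adjoint linear $M,N$ and a set $\mathcal S$ of pairs, a set-valued operator $E$ is $(M,N)$-semimonotone on $\mathcal S$ if $\langle x-y,u-v\rangle\ge\langle x-y,M(x-y)\rangle+\langle u-v,N(u-v)\rangle$ for all $(y,v)\in\mathcal S$ and $(x,u)\in\operatorname{gra}E$. A scalar in place of $M$ or $N$ denotes that multiple of the identity. $J_E=(\mathrm{Id}+E)^{-1}$. On $\mathbf H=\mathcal H\times\mathcal G$ define $\mathbf A(z,v)=(Az+L^*v)\times(B^{-1}v-Lz)$ and $\mathbf C(z,v)=(Cz,0)$. Assumption. $(\mu_A,\mu_B,\rho_A,\rho_B)\in\mathbb R^4$, $(\nu_A,\nu_B)\in[0,+\infty[^2$, and (i) $\rho_A+\rho_B\ge0$, $\mu_A+\mu_B\ge0$, ($\rho_A+\rho_B=0\Rightarrow\rho_A=\rho_B=0$), ($\mu_A+\mu_B=0\Rightarrow\mu_A=\mu_B=0$);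 (ii) $A$ is $(\nu_A\mathrm{Id}+\mu_AL^*L,\rho_A)$-semimonotone on $\{(x^*,-Cx^*-L^*u^* ):(x^*,u^* )\in\mathbf Z\}$; (iii) $B$ is $(\mu_B,\nu_B\mathrm{Id}+\rho_BLL^* )$-semimonotone on $\{(Lx^*,u^* ):(x^*,u^* )\in\mathbf Z\}$; (iv) $\Omega_A,\Omega_B\subset\,]0,+\infty[$ are nonempty sets such that, for every $(\tau,\sigma)\in\Omega_A\times\Omega_B$, $J_{\tau A}$ and $J_{\sigma B^{-1}}$ are single-valued with full domain; (v) $\operatorname{gra}(\mathbf A+\mathbf C)$ is sequentially weak-strong closed ($x_n\rightharpoonup x$, $u_n\to u$, $(x_n,u_n)$ in the graph imply $(x,u)$ in the graph). Definition of $\hat\rho$. With $\rho_{A,B}=\rho_A\rho_B/(\rho_A+\rho_B)$ if $\rho_A+\rho_B>0$ and $\mu_{A,B}=\mu_A\mu_B/(\mu_A+\mu_B)$ if $\mu_A+\mu_B>0$: $\hat\rho=\min\{0,\rho_{A,B},\frac{\tau}{\sigma}\mu_{A,B}\}$ if $\min\{\rho_A+\rho_B,\mu_A+\mu_B\}>0$; $\hat\rho=\min\{0,\frac\tau\sigma\mu_{A,B}\}$ if $\rho_A=\rho_B=0$ and $\mu_A+\mu_B>0$; $\hat\rho=\min\{0,\rho_{A,B}\}$ if $\mu_A=\mu_B=0$ and $\rho_A+\rho_B>0$; $\hat\rho=0$ if $\mu_A=\mu_B=\rho_A=\rho_B=0$. R-linear convergence of $(x_n)$ to $x$: $\|x_n-x\|\le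 c\,r^n$ for some $c\ge0$, $r\in\,]0,1[$. *)

(* Defs.v *)
From HB Require Import structures.
From mathcomp Require Import all_boot all_order all_algebra.
From mathcomp Require Import all_classical all_reals all_analysis.

Set Implicit Arguments.
Unset Strict Implicit.
Unset Printing Implicit Defensive.

Import Order.TTheory GRing.Theory Num.Theory.
Import numFieldNormedType.Exports.

Local Open Scope classical_set_scope.
Local Open Scope ring_scope.

(* Real Hilbert spaces: complete normed modules over a realType whose norm is
   induced by a symmetric, bilinear, positive definite form. *)
HB.mixin Record isHilbert (R : realType) T of CompleteNormedModule R T := {
  inner : {dot T for (@idfun R)};
  norm_inner : forall x : T, `|x| ^+ 2 = inner x x
}.

#[short(type="hilbertType")]
HB.structure Definition Hilbert (R : realType) :=
  {T of CompleteNormedModule R T & isHilbert R T}.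

Notation "''[' x , y ]" := (inner x y) : ring_scope.

Section BoundedOperators.
Context {R : realType} {H G : hilbertType R}.

Definition is_adjoint (L : H -> G) (Ls : G -> H) :=
  forall x u, '[L x, u] = '[x, Ls u].

Definition opnorm (L : H -> G) : R :=
  sup [set `|L x| | x in [set x : H | `|x| <= 1]].

Definition cocoercive (beta : R) (C : H -> H) :=
  forall x y, beta * `|C x - C y| ^+ 2 <= '[x - y, C x - C y].

(* Inner product and norm of the Hilbert direct sum of H and G. The library's
   norm on H * G is the max norm; it is equivalent to dsum_norm, so that strong
   convergence in H * G is the library's convergence in the product topology. *)
Definition dsum_inner (w w' : H * G) : R := '[w.1, w'.1] + '[w.2, w'.2].

Definition dsum_norm (w : H * G) : R := Num.sqrt (dsum_inner w w).

Definition weak_cvg (w : nat -> H * G) (l : H * G) :=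
  forall a : H * G, dsum_inner (w n) a @[n --> \oo] --> dsum_inner l a.

Definition R_linear_cvg (w : nat -> H * G) (l : H * G) :=
  exists c r : R, [/\ 0 <= c, 0 < r, r < 1 &
    forall n, dsum_norm (w n - l) <= c * r ^+ n].

Definition weak_strong_closed (S : set ((H * G) * (H * G))) :=
  forall (x u : nat -> H * G) (lx lu : H * G),
    (forall n, S (x n, u n)) -> weak_cvg x lx -> u @ \oo --> lu -> S (lx, lu).

End BoundedOperators.

(* A set-valued operator from U to V is a function U -> set V. *)
Section SetValuedOperators.
Context {R : realType}.

Definition graph (U V : Type) (E : U -> set V) : set (U * V) :=
  [set w | E w.1 w.2].

Definition inv_op (U V : Type) (E : U -> set V) : V -> set U :=
  fun v => [set u | E u v].

Definition add_op (U V : lmodType R) (E F : U -> set V) : U -> set V :=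
  fun x => [set u + v | u in E x & v in F x].

Definition scale_op (U V : lmodType R) (t : R) (E : U -> set V) : U -> set V :=
  fun x => [set t *: u | u in E x].

Definition fun_op (U V : Type) (f : U -> V) : U -> set V := fun x => [set f x].

Definition resolvent (U : lmodType R) (E : U -> set U) : U -> set U :=
  inv_op (add_op (fun_op idfun) E).

Definition single_valued_full_domain (U V : Type) (E : U -> set V) :=
  forall x, exists y, E x = [set y].

(* Intended for bounded self-adjoint linear M and N. *)
Definition semimonotone_on (E : hilbertType R) (M N : E -> E)
    (S : set (E * E)) (F : E -> set E) :=
  forall y v x u, S (y, v) -> graph F (x, u) ->
    '[x - y, M (x - y)] + '[u - v, N (u - v)] <= '[x - y, u - v].

End SetValuedOperators.

Section PrimalDual.
Context {R : realType} {H G : hilbertType R}.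
Variables (L : H -> G) (Ls : G -> H).
Variables (A : H -> set H) (B : G -> set G) (C : H -> H).

Definition solutions : set (H * G) :=
  [set w | add_op (add_op A (fun_op C)) (fun_op (fun=> Ls w.2)) w.1 0
           /\ B (L w.1) w.2].

Definition bigA : H * G -> set (H * G) :=
  fun w => [set a + Ls w.2 | a in A w.1]
           `*` [set x - L w.1 | x in inv_op B w.2].

Definition bigC : H * G -> H * G := fun w => (C w.1, 0).

End PrimalDual.

(* Only meaningful when rhoA + rhoB and muA + muB are nonnegative and each of
   these sums vanishes only if both its terms do; the last branch is then the
   case muA = muB = rhoA = rhoB = 0. *)
Definition rho_hat (R : realType) (muA muB rhoA rhoB tau sigma : R) : R :=
  let rhoAB := rhoA * rhoB / (rhoA + rhoB) in
  let muAB := muA * muB / (muA + muB) in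
  if 0 < Num.min (rhoA + rhoB) (muA + muB) then
    Num.min 0 (Num.min rhoAB (tau / sigma * muAB))
  else if [&& rhoA == 0, rhoB == 0 & 0 < muA + muB] then
    Num.min 0 (tau / sigma * muAB)
  else if [&& muA == 0, muB == 0 & 0 < rhoA + rhoB] then
    Num.min 0 rhoAB
  else 0.

(* Main.v *)
(** With P (z, v) = (z / tau - L^* v, v / sigma - L z), which is positive
    definite because s = sqrt (sigma tau) |L| < 1, the algorithm is a relaxed
    forward-backward iteration in the norm induced by P. Semimonotonicity at a
    solution and the parallel-sum inequality (a b / (a + b)) |x + y|^2 <= a
    |x|^2 + b |y|^2 bound the monotonicity gap from below by rho_hat times a
    squared residual. Comparing this residual with the P-norm and using
    cocoercivity gives a quadratic form whose discriminant is the polynomial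
    condition; hence the squared P-distance to every solution decreases by a
    multiple of the squared P-norm of the step, plus nuA and nuB terms. When
    nuA, nuB > 0 this is a contraction. In general steps tend to 0 and weak
    sequential cluster points are solutions, so Opial's argument applies. Weak
    cluster points are taken along ultrafilters; a sequence weakly converging
    to such a point is then extracted by choosing terms that are almost
    orthogonal to the previous ones after recentering. *)

Require Import Defs.
From HB Require Import structures.
From mathcomp Require Import all_boot all_order all_algebra.
From mathcomp Require Import all_classical all_reals all_analysis.
From mathcomp Require Import ring lra.

Set Implicit Arguments.
Unset Strict Implicit.
Unset Printing Implicit Defensive.

Import Order.TTheory GRing.Theory Num.Theory.
Import numFieldNormedType.Exports.

Local Open Scope classical_set_scope.
Local Open Scope ring_scope.

(** * Inner product calculus, Riesz representation, weak limits along ultrafilters *)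

Section InnerProduct.
Context {R : realType} {E : hilbertType R}.
Implicit Types x y a : E.

Lemma innerC x y : '[x, y] = '[y, x].
Proof. by rewrite hermC expr0 mul1r. Qed.

Lemma innerDl x y a : '[x + y, a] = '[x, a] + '[y, a].
Proof. exact: linearDl. Qed.

Lemma innerNl x a : '[- x, a] = - '[x, a].
Proof. exact: linearNl. Qed.

Lemma innerZl (t : R) x a : '[t *: x, a] = t * '[x, a].
Proof. exact: linearZl_LR. Qed.

Lemma inner0l a : '[0 : E, a] = 0.
Proof. by rewrite -(scale0r 0) innerZl mul0r. Qed.

Lemma innerDr x y a : '[a, x + y] = '[a, x] + '[a, y].
Proof. by rewrite innerC innerDl !(innerC a). Qed.

Lemma innerNr x a : '[a, - x] = - '[a, x].
Proof. by rewrite innerC innerNl (innerC a). Qed.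

Lemma innerZr (t : R) x a : '[a, t *: x] = t * '[a, x].
Proof. by rewrite innerC innerZl (innerC a). Qed.

Lemma inner0r a : '[a, 0 : E] = 0.
Proof. by rewrite innerC inner0l. Qed.

Definition innerE := (innerDl, innerDr, innerNl, innerNr, innerZl, innerZr).

Lemma inner_ge0 x : 0 <= '[x, x].
Proof. by rewrite -norm_inner sqr_ge0. Qed.

Lemma inner_eq0 x : '[x, x] = 0 -> x = 0.
Proof. by rewrite -norm_inner => /eqP; rewrite sqrf_eq0 normr_eq0 => /eqP. Qed.

(** The tool for vector identities below: testing against an arbitrary vector turns them into real
    identities that [ring] settles. *)
Lemma inner_inj x y : (forall a, '[x, a] = '[y, a]) -> x = y.
Proof.
move=> xy; apply/subr0_eq/inner_eq0.
by rewrite innerDl innerNl xy subrr.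
Qed.

Lemma cauchy_schwarz x y : '[x, y] ^+ 2 <= '[x, x] * '[y, y].
Proof.
have [/inner_eq0 ->|y0] := eqVneq '[y, y] 0.
  by rewrite !inner0r expr2 !mulr0.
have yy : 0 < '[y, y] by rewrite lt0r y0 inner_ge0.
have := inner_ge0 ('[y, y] *: x - '[x, y] *: y).
rewrite !innerE (innerC y x).
rewrite [leRHS](_ : _ = '[y, y] * ('[x, x] * '[y, y] - '[x, y] ^+ 2)).
  by rewrite pmulr_rge0// subr_ge0.
by ring.
Qed.

Lemma norm_inner_le x y : `|'[x, y]| <= `|x| * `|y|.
Proof.
rewrite -(@ler_pXn2r _ 2)// ?nnegrE ?mulr_ge0// exprMn !norm_inner.
by rewrite real_normK ?num_real//; exact: cauchy_schwarz.
Qed.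

Lemma cvg_inner (I : Type) (F : set_system I) {FF : Filter F} (u : I -> E) l a :
  u i @[i --> F] --> l -> '[u i, a] @[i --> F] --> '[l, a].
Proof.
move=> ul; apply/cvgrPdist_lt => e e0.
have d0 : 0 < e / (`|a| + 1) by rewrite divr_gt0// ltr_wpDl.
near=> i.
rewrite -innerNl -innerDl (le_lt_trans (norm_inner_le _ _))//.
have : `|l - u i| < e / (`|a| + 1) by near: i; move/cvgrPdist_lt : ul; apply.
rewrite ltr_pdivlMr ?ltr_wpDl// => /(le_lt_trans _); apply.
by rewrite ler_wpM2l// lerDl.
Unshelve. all: by end_near. Qed.

(* The representing vector minimizes |a|^2 - 2 f a; minimizing sequences are
   Cauchy by the parallelogram identity. *)
Lemma riesz (f : E -> R) (M : R) :
  (forall x y, f (x + y) = f x + f y) ->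
  (forall (t : R) x, f (t *: x) = t * f x) ->
  (forall x, `|f x| <= M * `|x|) ->
  exists l, forall a, f a = '[l, a].
Proof.
move=> fD fZ fM.
have fN x : f (- x) = - f x by rewrite -scaleN1r fZ mulN1r.
pose J x := '[x, x] - 2 * f x.
pose S := [set J x | x in [set: E]].
have J_lb x : - M ^+ 2 <= J x.
  have := fM x; have := sqr_ge0 (`|x| - M).
  rewrite /J -norm_inner; have := ler_norm (f x); nra.
have infS : has_inf S.
  split; first by exists (J 0); exists 0.
  by exists (- M ^+ 2) => _ [x _ <-].
have J_ge x : inf S <= J x by apply: ge_inf; [exact: infS.2|exists x].
have /choice[u uP] : forall n : nat, exists x, J x < inf S + n.+1%:R^-1.
  move=> n; have [|_ [x _ <-] ?] := @inf_adherent _ S n.+1%:R^-1 _ infS.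
    by rewrite invr_gt0.
  by exists x.
have u_dist n m : '[u n - u m, u n - u m] <= 2 * (n.+1%:R^-1 + m.+1%:R^-1).
  have := uP n; have := uP m; have := J_ge (2^-1 *: (u n + u m)).
  rewrite /J fZ fD !innerE (innerC (u m) (u n)).
  by move: n.+1%:R^-1 m.+1%:R^-1 => c1 c2; lra.
have /cvg_ex[l ul] : cvg (u @ \oo).
  apply: cauchy_cvg; apply/cauchyP => e e0.
  have d0 : 0 < e ^+ 2 / 4 by rewrite divr_gt0// exprn_gt0.
  have [N _ Ne] := near_infty_natSinv_lt (PosNum d0).
  exists (u N); exists N => //= n Nn; rewrite -ball_normE /ball_ /=.
  rewrite -(@ltr_pXn2r _ 2)// ?nnegrE//; last exact: ltW.
  rewrite norm_inner; apply: le_lt_trans (u_dist _ _) _.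
  have := Ne _ Nn; have := Ne _ (leqnn N) => /=.
  move: N.+1%:R^-1 n.+1%:R^-1 => c1 c2; lra.
exists l => a; apply/eqP; rewrite -subr_eq0; apply/eqP; set D := f a - '[l, a].
(* Compare [J (u n + t *: a) >= inf S] with [J (u n) < inf S + n.+1%:R^-1] and let [n] grow. A
   quadratic in [t] that is nonnegative everywhere and vanishes at 0 has no linear term, so
   [D = 0]. *)
have key (t : R) : 0 <= t ^+ 2 * '[a, a] - 2 * t * D.
  have h : (t ^+ 2 * '[a, a] - 2 * t * (f a - '[u n, a]) + n.+1%:R^-1)
      @[n --> \oo] --> t ^+ 2 * '[a, a] - 2 * t * D + 0.
    apply: cvgD; last exact: cvg_harmonic.
    apply: cvgB; first exact: cvg_cst.
    apply: cvgMr; apply: cvgB; first exact: cvg_cst.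
    exact: cvg_inner.
  rewrite -[leRHS]addr0 -(cvg_lim _ h)//; apply: limr_ge.
    by apply/cvg_ex; eexists; exact: h.
  near=> n; have := J_ge (u n + t *: a); have := uP n.
  rewrite /J fD fZ !innerE (innerC a (u n)); move: n.+1%:R^-1 => c1; lra.
have [a0|a0] := eqVneq '[a, a] 0; first by have := key D; rewrite a0; nra.
have {}a0 : 0 < '[a, a] by rewrite lt0r a0 inner_ge0.
have := key (D / '[a, a]).
rewrite [leRHS](_ : _ = - (D ^+ 2 / '[a, a])); last by field; exact: lt0r_neq0.
rewrite oppr_ge0 pmulr_lle0 ?invr_gt0// => D2.
by apply/eqP; rewrite -sqrf_eq0 eq_le D2 sqr_ge0.
Unshelve. all: by end_near. Qed.

(* Bounded real families converge along an ultrafilter, so the limits of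
   '[x i, a] form a bounded linear functional of a. *)
Lemma weak_ultra_limit (I : Type) (U : set_system I) (x : I -> E) (M : R) :
  UltraFilter U -> (forall i, `|x i| <= M) ->
  exists l, forall a, '[x i, a] @[i --> U] --> '[l, a].
Proof.
move=> UU xM.
have ucvg (a : E) : cvg ('[x i, a] @[i --> U]).
  have := @segment_compact R (- (M * `|a|)) (M * `|a|).
  rewrite compact_ultra => /(_ ('[x i, a] @[i --> U])) [].
  - split; first exact: fmap_proper_filter.
    (* Maximality of the image filter: if a member of [G] were missing from it, its complement would
       belong to the image filter, hence to [G] as well. *)
    move=> G GG UG; rewrite predeqE => A; split; last exact: UG.
    move=> GA.
    have [//|UnA] := in_ultra_setVsetC ((fun i => '[x i, a]) @^-1` A) UU.
    have : G (A `&` ~` A) by apply: filterI => //; apply: UG.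
    by rewrite setICr => /filter_not_empty.
  - rewrite /nbhs /=; apply: (@filterE _ U) => i /=.
    rewrite in_itv /= -ler_norml.
    by apply: (le_trans (norm_inner_le _ _)); rewrite ler_wpM2r.
  by move=> r [_ ur]; apply/cvg_ex; exists r.
have [|||l fl] := @riesz (fun a => lim ('[x i, a] @[i --> U])) M.
- move=> a b; apply/cvg_lim => //.
  under eq_fun do rewrite innerDr.
  by apply: cvgD; exact: ucvg.
- move=> t a; apply/cvg_lim => //.
  under eq_fun do rewrite innerZr.
  by apply: cvgMr; exact: ucvg.
- move=> a; rewrite -lim_norm //; apply: limr_le; first exact: is_cvg_norm.
  apply: filterE => i /=; apply: (le_trans (norm_inner_le _ _)).
  by rewrite ler_wpM2r.
by exists l => a; rewrite -fl; exact: ucvg.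
Qed.
End InnerProduct.

(** * From ultrafilter limits to weakly convergent subsequences *)

Section WeakSequences.
Context {R : realType}.

(* Banach-Saks: if '[x k, a] >= e infinitely often, a sum of m such vectors
   would have norm O(sqrt m) and yet pair to at least m * e with a. *)
Lemma almost_orthogonal_weak_cvg (E : hilbertType R) (x : nat -> E) (M : R) :
  (forall k, `|x k| <= M) ->
  (forall j k, (j < k)%N -> `|'[x k, x j]| <= k.+1%:R^-1) ->
  forall a, '[x k, a] @[k --> \oo] --> 0.
Proof.
move=> xM xx.
suff half a e : 0 < e -> \forall k \near \oo, '[x k, a] < e.
  move=> a; apply/cvgrPdist_lt => e e0.
  near=> k; rewrite sub0r normrN ltr_norml; apply/andP; split.
    rewrite ltrNl -innerNr; near: k; exact: half.
  by near: k; exact: half.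
move=> e0; apply: contrapT => nfar.
have far N : exists2 k, (N <= k)%N & e <= '[x k, a].
  apply: contrapT => nk; apply: nfar; exists N => //= k Nk.
  by rewrite ltNge; apply/negP => ek; apply: nk; exists k.
have M0 : 0 <= M by apply: le_trans (xM 0%N).
(* From [N] on, terms are nearly orthogonal to [s]. Adding a term of index [k >= N >= m] costs a
   cross product of at most [m / (k + 1) <= 1], so ['[s, s]] grows by at most [M ^+ 2 + 2]. *)
have sums m : exists s N, [/\ (m <= N)%N, '[s, s] <= m%:R * (M ^+ 2 + 2),
    m%:R * e <= '[s, a] &
    forall k, (N <= k)%N -> `|'[x k, s]| <= m%:R / k.+1%:R].
  elim: m => [|m [s [N [mN ss sa sx]]]].
    exists 0, 0%N; rewrite !inner0l !mul0r; split=> // k _.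
    by rewrite inner0r normr0 mul0r.
  have [k Nk ek] := far N; exists (s + x k), k.+1; split.
  - by rewrite ltnS (leq_trans mN).
  - have : '[x k, s] <= 1.
      apply: le_trans (ler_norm _) _; apply: le_trans (sx _ Nk) _.
      by rewrite ler_pdivrMr// mul1r ler_nat (leq_trans mN)// (leq_trans Nk).
    have : '[x k, x k] <= M ^+ 2 by rewrite -norm_inner lerXn2r ?nnegrE.
    rewrite !innerE (innerC s) -natr1; nra.
  - by rewrite -natr1 innerDl mulrDl mul1r lerD.
  - move=> j kj; rewrite innerDr (le_trans (ler_normD _ _))//.
    rewrite -natr1 mulrDl mul1r lerD//; last exact: xx.
    by apply: sx; rewrite (leq_trans Nk)// ltnW.
have bnd m : m.+1%:R * e ^+ 2 <= (M ^+ 2 + 2) * '[a, a].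
  have [s [N [_ ss sa _]]] := sums m.+1.
  have := cauchy_schwarz s a => cs.
  have m0 : (0 : R) < m.+1%:R by [].
  have h1 : (m.+1%:R * e) ^+ 2 <= '[s, a] ^+ 2.
    by rewrite lerXn2r ?nnegrE// ?(le_trans _ sa)// ?mulr_ge0// ltW.
  have h2 : '[s, s] * '[a, a] <= m.+1%:R * (M ^+ 2 + 2) * '[a, a].
    by rewrite ler_wpM2r// inner_ge0.
  rewrite -(ler_pM2l m0); have := le_trans h1 (le_trans cs h2).
  by move: m.+1%:R => c; lra.
(* [bnd] says that no positive integer exceeds [B]; the successor of [Num.truncn B] does. *)
pose B := (M ^+ 2 + 2) * '[a, a] / e ^+ 2.
have := bnd (Num.truncn B); rewrite -ler_pdivlMr ?exprn_gt0// leNgt.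
by rewrite truncnS_gt.
Unshelve. all: by end_near. Qed.

Lemma cvg0_of_sqr (E : hilbertType R) (x : nat -> E) (N : nat -> R) (k : R) :
  0 < k -> (forall n, k * '[x n, x n] <= N n) -> N n @[n --> \oo] --> 0 ->
  x n @[n --> \oo] --> 0.
Proof.
move=> k0 xN N0; apply/cvgr0Pnorm_lt => e e0.
have ke : 0 < k * e ^+ 2 by rewrite mulr_gt0// exprn_gt0.
have /cvgr0Pnorm_lt/(_ _ ke) := N0.
apply: filterS => n /(le_lt_trans (ler_norm _)) Nn.
rewrite -(@ltr_pXn2r _ 2)// ?nnegrE ?(ltW e0)// norm_inner -(ltr_pM2l k0).
exact: le_lt_trans (xN n) Nn.
Qed.

Lemma cvg0_of_norm_le (E F : hilbertType R) (x : nat -> E) (y : nat -> F)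
    (K : R) :
  (forall n, `|y n| <= K * `|x n|) -> x n @[n --> \oo] --> 0 ->
  y n @[n --> \oo] --> 0.
Proof.
move=> yx /norm_cvg0P x0; apply/norm_cvg0P.
have Kx : K * `|x n| @[n --> \oo] --> 0.
  by rewrite -[X in _ --> X](mulr0 K); exact: cvgMr.
apply: squeeze_cvgr Kx; last exact: cvg_cst.
by apply: filterE => n; rewrite normr_ge0 yx.
Qed.

(** Almost orthogonality to the finitely many recentered terms already chosen, for [x] and [y] at
    once, holds on a set of [U]. As [U] refines [\oo], that set contains an index beyond any
    bound. *)
Lemma weak_subsequence (H G : hilbertType R) (U : set_system nat)
    (x : nat -> H) (y : nat -> G) (lx : H) (ly : G) (M : R) :
  ProperFilter U -> \oo `<=` U ->
  (forall n, `|x n| <= M) -> (forall n, `|y n| <= M) ->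
  (forall a, '[x n, a] @[n --> U] --> '[lx, a]) ->
  (forall a, '[y n, a] @[n --> U] --> '[ly, a]) ->
  exists phi : nat -> nat, [/\ forall k, (k <= phi k)%N,
    forall a, '[x (phi k), a] @[k --> \oo] --> '[lx, a] &
    forall a, '[y (phi k), a] @[k --> \oo] --> '[ly, a]].
Proof.
move=> PU ooU xM yM xl yl.
have small (E : hilbertType R) (u : nat -> E) l a e : 0 < e ->
    (forall b, '[u n, b] @[n --> U] --> '[l, b]) ->
    \forall n \near U, `|'[u n - l, a]| <= e.
  move=> e0 ul; have /cvgrPdist_le/(_ e e0) := ul a.
  apply: filterS => n; rewrite distrC innerDl innerNl; exact.
pose close n k j := `|'[x n - lx, x j - lx]| <= k.+1%:R^-1 /\
                    `|'[y n - ly, y j - ly]| <= k.+1%:R^-1.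
have near_close k (s : seq nat) :
    \forall n \near U, (k <= n)%N /\ forall j, j \in s -> close n k j.
  elim: s => [|i s IH].
    by apply: filterS (ooU _ (nbhs_infty_ge k)) => n kn; split.
  have k0 : 0 < k.+1%:R^-1 :> R by rewrite invr_gt0.
  apply: filterS3 IH (small _ _ _ (x i - lx) _ k0 xl)
    (small _ _ _ (y i - ly) _ k0 yl) => n [kn sc] hx hy.
  by split=> // j; rewrite inE => /predU1P[->//|/sc].
have /choice[h hP] : forall p : nat * seq nat, exists n,
    (p.1 <= n)%N /\ forall j, j \in p.2 -> close n p.1 j.
  by move=> p; exact: filter_ex (near_close p.1 p.2).
(* [hist k] collects the indices [phi 0, ..., phi (k - 1)]: the choice of [phi k] depends on all of
   them, not only on the last. *)
pose hist := fix hist k := if k is i.+1 then h (i, hist i) :: hist i else [::].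
pose phi k := h (k, hist k).
have mem_hist j k : (j < k)%N -> phi j \in hist k.
  elim: k => // k IH; rewrite ltnS leq_eqVlt => /predU1P[->|/IH jk] /=.
    by rewrite inE eqxx.
  by rewrite inE jk orbT.
have phiP j k : (j < k)%N -> close (phi k) k (phi j).
  by move=> /mem_hist; exact: (hP (k, hist k)).2.
have lim0 (E : hilbertType R) (u : nat -> E) l : (forall n, `|u n| <= M) ->
    (forall j k, (j < k)%N ->
      `|'[u (phi k) - l, u (phi j) - l]| <= k.+1%:R^-1) ->
    forall a, '[u (phi k), a] @[k --> \oo] --> '[l, a].
  move=> uM uu a.
  have /(_ a) h0 := almost_orthogonal_weak_cvg (M := M + `|l|)
    (fun k => le_trans (ler_normB _ _) (lerD (uM (phi k)) (lexx _))) uu.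
  have -> : (fun k => '[u (phi k), a]) =
      (fun k => '[u (phi k) - l, a] + '[l, a]).
    by apply/funext => k; rewrite -innerDl subrK.
  rewrite -[X in _ --> X]add0r; apply: cvgD h0 _; exact: cvg_cst.
exists phi; split; first by move=> k; exact: (hP (k, hist k)).1.
- by apply: lim0 => // j k /phiP[].
- by apply: lim0 => // j k /phiP[].
Qed.

End WeakSequences.

(** * Opial's argument in the direct sum *)

Section DirectSum.
Context {R : realType} {H G : hilbertType R}.
Implicit Types x y w : H * G.

Lemma dsum_innerC x y : dsum_inner x y = dsum_inner y x.
Proof. by rewrite /dsum_inner innerC (innerC x.2). Qed.

Lemma dsum_innerBl x y w :
  dsum_inner (x - y) w = dsum_inner x w - dsum_inner y w.
Proof. by rewrite /dsum_inner /= !innerE; ring. Qed.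

Lemma dsum_innerBr x y w :
  dsum_inner w (x - y) = dsum_inner w x - dsum_inner w y.
Proof. by rewrite !(dsum_innerC w) dsum_innerBl. Qed.

(** For two cluster points in [Z], the difference of the squared [P]-distances is affine in [w n],
    so [dsum_inner (w n) (P (l - l'))] converges. Its values at [l] and [l'] then agree, and
    definiteness of [P] gives [l = l']. *)
Lemma opial (P : H * G -> H * G) (Z : set (H * G)) (w : nat -> H * G) (M : R) :
  (forall x y, P (x - y) = P x - P y) ->
  (forall x y, dsum_inner (P x) y = dsum_inner x (P y)) ->
  (forall x, dsum_inner x (P x) = 0 -> x = 0) ->
  (forall n, `|(w n).1| <= M) -> (forall n, `|(w n).2| <= M) ->
  (forall l, Z l -> cvg (dsum_inner (w n - l) (P (w n - l)) @[n --> \oo])) ->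
  (forall phi l, (forall k, (k <= phi k)%N) -> weak_cvg (w \o phi) l -> Z l) ->
  exists2 l, Z l & weak_cvg w l.
Proof.
move=> PB Psym P0 w1M w2M Zcvg Zcluster.
have ultra_lim (U : set_system nat) : UltraFilter U -> \oo `<=` U ->
    exists2 l, Z l & forall a, dsum_inner (w n) a @[n --> U] --> dsum_inner l a.
  move=> UU ooU.
  have [l1 wl1] := weak_ultra_limit UU w1M.
  have [l2 wl2] := weak_ultra_limit UU w2M.
  have [phi [phik h1 h2]] := weak_subsequence _ ooU w1M w2M wl1 wl2.
  exists (l1, l2); last by move=> a; apply: cvgD; [exact: wl1|exact: wl2].
  apply: (Zcluster phi) => // a; apply: cvgD; [exact: h1|exact: h2].
have uniq (U V : set_system nat) l l' : ProperFilter U -> ProperFilter V ->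
    \oo `<=` U -> \oo `<=` V -> Z l -> Z l' ->
    (forall a, dsum_inner (w n) a @[n --> U] --> dsum_inner l a) ->
    (forall a, dsum_inner (w n) a @[n --> V] --> dsum_inner l' a) -> l = l'.
  move=> PU PV ooU ooV Zl Zl' wl wl'.
  have /cvg_ex[r wr] : cvg (dsum_inner (w n) (P (l - l')) @[n --> \oo]).
    have -> : (fun n => dsum_inner (w n) (P (l - l'))) = (fun n =>
       2^-1 * (dsum_inner (w n - l') (P (w n - l')) -
        dsum_inner (w n - l) (P (w n - l)) +
        (dsum_inner l (P l) - dsum_inner l' (P l')))).
      apply/funext => n; rewrite !PB !dsum_innerBl !dsum_innerBr.
      rewrite -(Psym l (w n)) -(Psym l' (w n)).
      by rewrite !(dsum_innerC (P _) (w n)); field.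
    apply: is_cvgMr; apply: is_cvgD; last exact: is_cvg_cst.
    by apply: is_cvgB; exact: Zcvg.
  have E : dsum_inner l (P (l - l')) = dsum_inner l' (P (l - l')).
    transitivity r; [|apply/esym].
    - apply: (cvg_unique _ (wl (P (l - l')))) => //.
      by apply: cvg_trans wr; apply: cvg_app.
    - apply: (cvg_unique _ (wl' (P (l - l')))) => //.
      by apply: cvg_trans wr; apply: cvg_app.
  by apply/subr0_eq/P0; rewrite dsum_innerBl E subrr.
have [U [UU ooU]] := @ultraFilterLemma nat \oo _.
have [l Zl wl] := ultra_lim U UU ooU.
exists l => // a; apply/cvgrPdist_lt => e e0; apply: contrapT => far.
(* If weak convergence to [l] fails, the indices where it fails form an infinite set, which carries
   an ultrafilter finer than [\oo]. The limit along it is again [l] by uniqueness, a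
   contradiction. *)
pose A := [set n | ~ `|dsum_inner l a - dsum_inner (w n) a| < e].
have PA : ProperFilter (within A \oo).
  split; last exact: within_filter.
  rewrite /within /= => A0; apply: far; apply: filterS A0 => n nA.
  by apply: contrapT => An; apply: (nA An).
have [V [VV AV]] := ultraFilterLemma PA.
have ooV : \oo `<=` V.
  by move=> B ooB; apply: AV; apply: filterS ooB => n Bn _.
have [l' Zl' wl'] := ultra_lim V VV ooV.
have ll' := uniq U V l l' (@ultra_proper _ _ UU) (@ultra_proper _ _ VV)
  ooU ooV Zl Zl' wl wl'.
have VA : V A by apply: AV; exact: withinT.
have /cvgrPdist_lt/(_ e e0) VnA := wl' a; rewrite -ll' in VnA.
by have [n [/= An nAn]] := filter_ex (filterI VA VnA); exact: An.
Qed.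

End DirectSum.

(** * Scalar estimates: parallel sums, [rho_hat], a discriminant bound *)

Section ParallelSum.
Context {R : realType}.

(** The identity behind it, valid for [a] and [b] of any sign: [(a + b) (a |x|^2 + b |y|^2) - a b |x
    + y|^2 = |a x - b y|^2]. *)
Lemma parallel_sum_le (E : hilbertType R) (a b k : R) (x y : E) :
  0 <= a + b -> (a + b = 0 -> a = 0 /\ b = 0) -> k <= 0 ->
  (0 < a + b -> k <= a * b / (a + b)) ->
  k * '[x + y, x + y] <= a * '[x, x] + b * '[y, y].
Proof.
move=> ab0 abE k0 kab; have [ab|] := ltrP 0 (a + b); last first.
  move=> ab; have [-> ->] : a = 0 /\ b = 0 by apply/abE/eqP; rewrite eq_le ab.
  by rewrite !mul0r addr0 mulr_le0_ge0// inner_ge0.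
apply: (@le_trans _ _ (a * b / (a + b) * '[x + y, x + y])).
  by rewrite ler_wpM2r ?inner_ge0// kab.
rewrite mulrAC ler_pdivrMr// -subr_ge0.
apply: le_trans (inner_ge0 (a *: x - b *: y)) _.
rewrite le_eqVlt; apply/orP; left; apply/eqP.
by rewrite !innerE (innerC y x); ring.
Qed.

(** Every later use of [rho_hat] goes through these three bounds, which hide its case distinction
    and match the premises of [parallel_sum_le]. *)
Lemma rho_hatP (muA muB rhoA rhoB tau sigma : R) :
  0 <= rhoA + rhoB -> 0 <= muA + muB ->
  (rhoA + rhoB = 0 -> rhoA = 0 /\ rhoB = 0) ->
  (muA + muB = 0 -> muA = 0 /\ muB = 0) ->
  [/\ rho_hat muA muB rhoA rhoB tau sigma <= 0,
    0 < rhoA + rhoB -> rho_hat muA muB rhoA rhoB tau sigma <=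
      rhoA * rhoB / (rhoA + rhoB) &
    0 < muA + muB -> rho_hat muA muB rhoA rhoB tau sigma <=
      tau / sigma * (muA * muB / (muA + muB))].
Proof.
move=> rho0 mu0 rhoE muE; rewrite /rho_hat /= lt_min.
have [r0|r0] : rhoA + rhoB = 0 \/ 0 < rhoA + rhoB.
- by move: rho0; rewrite le_eqVlt => /predU1P[|]; [left|right].
all: have [m0|m0] : muA + muB = 0 \/ 0 < muA + muB by
  move: mu0; rewrite le_eqVlt => /predU1P[|]; [left|right].
- have [-> ->] := rhoE r0; have [-> ->] := muE m0.
  by rewrite !addr0 ltxx !andbF /=; split; rewrite ?lexx.
- have [-> ->] := rhoE r0; rewrite !addr0 ltxx m0 eqxx /=.
  by split=> [|//|//]; rewrite !ge_min ?lexx ?orbT.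
- have [-> ->] := muE m0; rewrite !addr0 ltxx r0 eqxx !andbF /=.
  by split=> [|//|//]; rewrite !ge_min ?lexx ?orbT.
- by rewrite r0 m0 /=; split=> [|_|_]; rewrite !ge_min ?lexx ?orbT.
Qed.

(** By the arithmetic-geometric mean inequality, [2 |h| sqrt (N g) <= b g + (h^2 / b) N]; the proof
    compares squares to avoid the root. *)
Lemma discriminant_lower_bound (a b h N g x : R) :
  0 < b -> 0 <= N -> 0 <= g -> x ^+ 2 <= N * g ->
  (a - h ^+ 2 / b) * N <= a * N + b * g - 2 * h * x.
Proof.
move=> b0 N0 g0 xNg.
suff : 2 * h * x <= b * g + h ^+ 2 / b * N by lra.
have t0 : 0 <= b * g + h ^+ 2 / b * N.
  by have b_ge0 := ltW b0; rewrite addr_ge0// mulr_ge0// divr_ge0// sqr_ge0.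
have [|hx] := leP (2 * h * x) 0; first by move/le_trans; apply.
rewrite -(@ler_pXn2r _ 2)// ?nnegrE ?(ltW hx)//.
apply: (@le_trans _ _ (4 * h ^+ 2 * (N * g))).
  have := ler_wpM2l (sqr_ge0 h) xNg; lra.
rewrite -subr_ge0; apply: le_trans (sqr_ge0 (b * g - h ^+ 2 / b * N)) _.
rewrite le_eqVlt; apply/orP; left; apply/eqP; field; exact: lt0r_neq0.
Qed.

End ParallelSum.

(** * The operator norm and the adjoint *)

Section Operator.
Context {R : realType} {H G : hilbertType R}.
Variables (L : {linear H -> G}) (Ls : G -> H).
Hypothesis L_bounded : bounded_fun_norm L.
Hypothesis Ls_adjoint : is_adjoint L Ls.

(** [Ls] is given as a bare function; its linearity is recovered from the adjoint relation. *)
Lemma adjointD u v : Ls (u + v) = Ls u + Ls v.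
Proof.
apply: inner_inj => a.
by rewrite innerDl !(innerC _ a) -!Ls_adjoint innerDr.
Qed.

Lemma adjointZ (t : R) u : Ls (t *: u) = t *: Ls u.
Proof.
apply: inner_inj => a.
by rewrite innerZl !(innerC _ a) -!Ls_adjoint innerZr.
Qed.

Lemma adjointB u v : Ls (u - v) = Ls u - Ls v.
Proof. by rewrite -scaleN1r adjointD adjointZ scaleN1r. Qed.

Lemma opnorm_has_sup :
  has_sup [set `|L x| | x in [set x : H | `|x| <= 1]].
Proof.
have [M LM] := L_bounded 1; split; last first.
  by exists M => _ [x x1 <-]; exact: LM.
by exists `|L 0|, 0; rewrite //= normr0.
Qed.

Lemma opnorm_ge0 : 0 <= opnorm L.
Proof.
apply: le_trans (normr_ge0 (L 0)) _.
apply: ub_le_sup; first exact: opnorm_has_sup.2.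
by exists 0; rewrite //= normr0.
Qed.

Lemma opnormP x : `|L x| <= opnorm L * `|x|.
Proof.
have [->|x0] := eqVneq x 0; first by rewrite linear0 !normr0 mulr0.
have nx0 : 0 < `|x| by rewrite normr_gt0.
rewrite -ler_pdivrMr//; apply: ub_le_sup; first exact: opnorm_has_sup.2.
exists (`|x|^-1 *: x); rewrite /= ?linearZ /= normrZ normfV normr_id.
  by rewrite mulVf// gt_eqF.
by rewrite mulrC.
Qed.

Lemma adjoint_norm_le u : `|Ls u| <= opnorm L * `|u|.
Proof.
have [->|u0] := eqVneq (Ls u) 0; first by rewrite normr0 mulr_ge0// opnorm_ge0.
have nu0 : 0 < `|Ls u| by rewrite normr_gt0.
rewrite -(ler_pM2l nu0) -expr2 norm_inner -Ls_adjoint.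
apply: le_trans (ler_norm _) _; apply: le_trans (norm_inner_le _ _) _.
by apply: le_trans (ler_wpM2r (normr_ge0 u) (opnormP _)) _; lra.
Qed.

Lemma inner_opnorm_le x u : `|'[L x, u]| <= opnorm L * `|x| * `|u|.
Proof.
by apply: le_trans (norm_inner_le _ _) _; rewrite ler_wpM2r// opnormP.
Qed.

(** * The preconditioner and the squared norm it induces *)

Variables (tau sigma : R).
Hypotheses (tau0 : 0 < tau) (sigma0 : 0 < sigma).
Let s := Num.sqrt (sigma * tau) * opnorm L.
Hypothesis s1 : s < 1.

Definition precond (w : H * G) : H * G :=
  (tau^-1 *: w.1 - Ls w.2, sigma^-1 *: w.2 - L w.1).

Definition energy (w : H * G) : R := dsum_inner w (precond w).

Lemma precondB x y : precond (x - y) = precond x - precond y.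
Proof.
by congr pair; rewrite /= ?adjointB ?linearB/=; apply: inner_inj => a;
  rewrite !innerE; ring.
Qed.

Lemma precondZ (t : R) x : precond (t *: x) = t *: precond x.
Proof.
congr pair; rewrite /=.
- by rewrite adjointZ; apply: inner_inj => a; rewrite !innerE; ring.
- by rewrite [L _]linearZ /=; apply: inner_inj => a; rewrite !innerE; ring.
Qed.

Lemma precond_sym x y : dsum_inner (precond x) y = dsum_inner x (precond y).
Proof.
rewrite /dsum_inner /= !innerE -(Ls_adjoint x.1) (innerC (Ls _)) -Ls_adjoint.
rewrite (innerC x.2 (L _)); ring.
Qed.

Lemma energyE w : energy w =
  tau^-1 * '[w.1, w.1] + sigma^-1 * '[w.2, w.2] - 2 * '[L w.1, w.2].
Proof.
rewrite /energy /dsum_inner /= !innerE -Ls_adjoint (innerC w.2 (L _)); ring.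
Qed.

Lemma energyB w t :
  energy (w - t) = energy w - 2 * dsum_inner t (precond w) + energy t.
Proof.
rewrite /energy precondB !dsum_innerBl !dsum_innerBr -(precond_sym w t).
rewrite (dsum_innerC (precond w)); ring.
Qed.

Lemma energyZ (t : R) w : energy (t *: w) = t ^+ 2 * energy w.
Proof. by rewrite !energyE /= [L (t *: _)]linearZ /= !innerE; ring. Qed.

Lemma step_norm_ge0 : 0 <= s.
Proof. by rewrite mulr_ge0 ?sqrtr_ge0 ?opnorm_ge0. Qed.

Lemma step_normE : s ^+ 2 = sigma * tau * opnorm L ^+ 2.
Proof. by rewrite exprMn sqr_sqrtr// mulr_ge0// ltW. Qed.

Lemma step_norm_compl_gt0 : 0 < 1 - s ^+ 2.
Proof. by rewrite subr_gt0 expr_lt1// step_norm_ge0. Qed.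

(** Young's inequality [2 l a b <= b^2 / sigma + sigma l^2 a^2] uses up the whole second component
    and leaves the coefficient [1 / tau - sigma l^2] on the first. [energy_ge2] exchanges the
    roles. *)
Lemma energy_ge1 w : (1 - s ^+ 2) / tau * '[w.1, w.1] <= energy w.
Proof.
have := inner_opnorm_le w.1 w.2; have := ler_norm '[L w.1, w.2].
rewrite energyE step_normE -!norm_inner.
move: (opnorm L) `|w.1| `|w.2| => l a b k1 k2.
have := sqr_ge0 (b / sigma - l * a) => h.
have -> : (1 - sigma * tau * l ^+ 2) / tau * a ^+ 2 =
  tau^-1 * a ^+ 2 - sigma * (l * a) ^+ 2 by field; exact: lt0r_neq0.
have : 0 <= sigma * (b / sigma - l * a) ^+ 2 by rewrite mulr_ge0// ltW.
have -> : sigma * (b / sigma - l * a) ^+ 2 =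
  sigma^-1 * b ^+ 2 - 2 * (l * a * b) + sigma * (l * a) ^+ 2.
  by field; exact: lt0r_neq0.
move: k1 k2; move: '[_, _] => x; lra.
Qed.

Lemma energy_ge2 w : (1 - s ^+ 2) / sigma * '[w.2, w.2] <= energy w.
Proof.
have := inner_opnorm_le w.1 w.2; have := ler_norm '[L w.1, w.2].
rewrite energyE step_normE -!norm_inner.
move: (opnorm L) `|w.1| `|w.2| => l a b k1 k2.
have -> : (1 - sigma * tau * l ^+ 2) / sigma * b ^+ 2 =
  sigma^-1 * b ^+ 2 - tau * (l * b) ^+ 2 by field; exact: lt0r_neq0.
have : 0 <= tau * (a / tau - l * b) ^+ 2 by rewrite mulr_ge0 ?sqr_ge0// ltW.
have -> : tau * (a / tau - l * b) ^+ 2 =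
  tau^-1 * a ^+ 2 - 2 * (l * a * b) + tau * (l * b) ^+ 2.
  by field; exact: lt0r_neq0.
move: k1 k2; move: '[_, _] => x; lra.
Qed.

Lemma energy_ge0 w : 0 <= energy w.
Proof.
apply: le_trans (energy_ge1 w).
by rewrite mulr_ge0 ?divr_ge0 ?inner_ge0 ?ltW// step_norm_compl_gt0.
Qed.

Lemma energyD_le x y : energy (x + y) <= 2 * (energy x + energy y).
Proof.
have := energy_ge0 (x - y).
rewrite !energyE /= !linearB !linearD /= !innerE.
rewrite (innerC y.1 x.1) (innerC y.2 x.2); lra.
Qed.

Lemma energy_eq0 w : energy w = 0 -> w = 0.
Proof.
have g1 : 0 < (1 - s ^+ 2) / tau by rewrite divr_gt0// step_norm_compl_gt0.
have g2 : 0 < (1 - s ^+ 2) / sigma by rewrite divr_gt0// step_norm_compl_gt0.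
have := energy_ge1 w; have := energy_ge2 w; case: w => x u /= + + w0.
rewrite w0 !pmulr_rle0// => u0 x0; congr pair; apply/inner_eq0/eqP.
- by rewrite eq_le x0 inner_ge0.
- by rewrite eq_le u0 inner_ge0.
Qed.

(** With [t] and [q] the square roots of [tau] and [sigma], expanding [s (a / t - b / q)^2 >= 0]
    bounds the cross term [2 |L| a b] by [s (a^2 / tau + b^2 / sigma)]. *)
Lemma energy_le w :
  energy w <= (1 + s) * (tau^-1 * '[w.1, w.1] + sigma^-1 * '[w.2, w.2]).
Proof.
have := ler_norm (- '[L w.1, w.2]); rewrite normrN.
move=> /le_trans /(_ (inner_opnorm_le _ _)).
rewrite energyE -!norm_inner mulrDl mul1r.
have sE : s = Num.sqrt sigma * Num.sqrt tau * opnorm L.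
  by rewrite /s sqrtrM// ltW.
have sg : sigma^-1 = (Num.sqrt sigma ^+ 2)^-1 by rewrite sqr_sqrtr// ltW.
have st : tau^-1 = (Num.sqrt tau ^+ 2)^-1 by rewrite sqr_sqrtr// ltW.
have sg0 : 0 < Num.sqrt sigma by rewrite sqrtr_gt0.
have st0 : 0 < Num.sqrt tau by rewrite sqrtr_gt0.
have l0 := opnorm_ge0.
move: (opnorm L) `|w.1| `|w.2| '[_, _] l0 sE => l a b x l0 -> k.
rewrite st sg; move: (Num.sqrt tau) (Num.sqrt sigma) sg0 st0 => t q q0 t0.
have : 0 <= q * t * l * (a / t - b / q) ^+ 2.
  by rewrite mulr_ge0 ?sqr_ge0// !mulr_ge0// ltW.
have -> : q * t * l * (a / t - b / q) ^+ 2 =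
  q * t * l * ((t ^+ 2)^-1 * a ^+ 2 + (q ^+ 2)^-1 * b ^+ 2) - 2 * (l * a * b).
  by field; rewrite !lt0r_neq0.
lra.
Qed.

(* Without inverting the preconditioner P, this is the statement that
   |P w - c|^2 <= (1 + s) * energy (w - P^-1 c), in weighted norms and with the
   energy of P^-1 c replaced by its upper bound; it is obtained by testing the
   positivity of the energy at w - t with t proportional to P w - c. *)
Lemma residual_le (w y : H * G) (c : H) :
  y = precond w - (c, 0) ->
  tau * '[y.1, y.1] + sigma * '[y.2, y.2] <=
  (1 + s) * (energy w - 2 * '[w.1, c] + '[c, c] / ((1 - s ^+ 2) / tau)).
Proof.
set g := (1 - s ^+ 2) / tau; move=> yE.
have g0 : 0 < g by rewrite divr_gt0// step_norm_compl_gt0.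
have k0 : 0 < 1 + s by rewrite ltr_pwDl// step_norm_ge0.
set W := _ + _.
(* The factor [(1 + s)^-1] is the [k] that maximizes [2 k W - (1 + s) k^2 W]. *)
pose t : H * G := ((1 + s)^-1 * tau *: y.1, (1 + s)^-1 * sigma *: y.2).
have te : energy t <= W / (1 + s).
  apply: le_trans (energy_le t) _; rewrite /t /= !innerE /W le_eqVlt.
  by apply/orP; left; apply/eqP; field; rewrite !lt0r_neq0.
have ty : dsum_inner t (precond w) - '[t.1, c] = W / (1 + s).
  have -> : precond w = y + (c, 0) by rewrite yE subrK.
  by rewrite /dsum_inner /t /= addr0 !innerE /W; ring.
(* The energy is at least [g |x|^2] with [x = w.1 - t.1]; completing the square leaves
   [|g x - c|^2 / g]. *)
have pos : 0 <= energy (w - t) - 2 * '[w.1 - t.1, c] + '[c, c] / g.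
  have := energy_ge1 (w - t); rewrite -/g /= => e1.
  have h : 0 <= '[g *: (w.1 - t.1) - c, g *: (w.1 - t.1) - c] / g.
    by rewrite divr_ge0 ?inner_ge0// ltW.
  apply: (le_trans h); move: (w.1 - t.1) e1 => x e1.
  have -> : '[g *: x - c, g *: x - c] / g =
      g * '[x, x] - 2 * '[x, c] + '[c, c] / g.
    by rewrite !innerE (innerC c x); field; exact: lt0r_neq0.
  by rewrite lerD2r lerD2r.
rewrite mulrC -ler_pdivrMr//.
move: pos; rewrite energyB innerDl innerNl; lra.
Qed.

End Operator.

(** * The descent inequality for one step *)

Section Algorithm.
Context {R : realType} {H G : hilbertType R}.
Variables (L : {linear H -> G}) (Ls : G -> H).
Variables (A : H -> set H) (B : G -> set G) (C : H -> H).
Variables (beta muA muB rhoA rhoB nuA nuB tau sigma theta : R).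
Hypotheses (L_bounded : bounded_fun_norm L) (Ls_adjoint : is_adjoint L Ls).
Hypotheses (beta0 : 0 < beta) (C_cocoercive : cocoercive beta C).
Hypotheses (nuA0 : 0 <= nuA) (nuB0 : 0 <= nuB).
Hypotheses (rho_ge0 : 0 <= rhoA + rhoB) (mu_ge0 : 0 <= muA + muB).
Hypothesis rho_eq0 : rhoA + rhoB = 0 -> rhoA = 0 /\ rhoB = 0.
Hypothesis mu_eq0 : muA + muB = 0 -> muA = 0 /\ muB = 0.
Let Z := solutions L Ls A B C.
Hypothesis A_semimonotone :
  semimonotone_on (fun x => nuA *: x + muA *: Ls (L x)) (fun u => rhoA *: u)
    [set (w.1, - C w.1 - Ls w.2) | w in Z] A.
Hypothesis B_semimonotone :
  semimonotone_on (fun x => muB *: x) (fun u => nuB *: u + rhoB *: L (Ls u))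
    [set (L w.1, w.2) | w in Z] B.
Hypotheses (tau0 : 0 < tau) (sigma0 : 0 < sigma).
Hypotheses (theta0 : 0 < theta).
Let rho := rho_hat muA muB rhoA rhoB tau sigma.
Let s := Num.sqrt (sigma * tau) * opnorm L.
Hypothesis step_condition : s < (beta + rho) / beta.
Hypothesis poly_condition :
  let l := opnorm L in
  0 < - (1 + 2 * beta * sigma * l ^+ 2 * (2 - theta)) * tau ^+ 2
      - 2 * rho * Num.sqrt sigma * l
          * (2 * beta * sigma * l ^+ 2 + theta) * tau `^ (3 / 2)
      + 2 * (beta * (2 - theta) - rho * (2 * beta * sigma * l ^+ 2 + theta))
          * tau
      + 4 * beta * rho * Num.sqrt sigma * l * tau `^ (1 / 2)
      + 4 * beta * rho.

Let P := precond L Ls tau sigma.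
Let En := energy L Ls tau sigma.
(** Let [N] be the energy of the step, [c] the difference of the values of [C] at the iterate and at
    a solution, [gam = |c|^2 / g], and [x] the inner product of [c] with the primal step. The
    estimates in [descent] lead to the form [(2 - theta - 2 r) N + b gam - 2 h x] with
    [x^2 <= N gam]; [eps] is the coefficient of [N] that survives. *)
Let g := (1 - s ^+ 2) / tau.
Let r := - rho * (1 + s) / tau.
Let b := 2 * (beta * g - r).
Let h := 1 - 2 * r.
Let eps := 2 - theta - 2 * r - h ^+ 2 / b.

Let rho_le0 : rho <= 0.
Proof. by have [] := rho_hatP tau sigma rho_ge0 mu_ge0 rho_eq0 mu_eq0. Qed.

Let s_lt1 : s < 1.
Proof.
by apply: lt_le_trans step_condition _; rewrite ler_pdivrMr// mul1r gerDl.
Qed.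

Let s_ge0 : 0 <= s.
Proof. exact: step_norm_ge0. Qed.

Let g_gt0 : 0 < g.
Proof. by rewrite divr_gt0// subr_gt0 expr_lt1. Qed.

(** Up to the positive factor [(1 + s) / tau], this is the step-size condition. *)
Let b_gt0 : 0 < b.
Proof.
rewrite /b mulr_gt0//.
have -> : beta * g - r = (1 + s) / tau * (beta + rho - s * beta).
  by rewrite /g /r; ring.
by apply: mulr_gt0; [rewrite divr_gt0// ltr_pwDl|rewrite subr_gt0 -ltr_pdivlMr].
Qed.

(* The polynomial condition is tau^2 ((2 - theta - 2 r) b - h^2) > 0, with
   coefficients in sqrt tau because s = sqrt (sigma tau) |L|. *)
Let eps_gt0 : 0 < eps.
Proof.
rewrite /eps subr_gt0 ltr_pdivrMr// -subr_gt0.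
have t2 : 0 < tau ^+ 2 by rewrite exprn_gt0.
rewrite -(pmulr_rgt0 _ t2).
have st0 : 0 < Num.sqrt tau by rewrite sqrtr_gt0.
have stE := sqr_sqrtr (ltW tau0).
have p1 : tau `^ (1 / 2) = Num.sqrt tau by rewrite -powR12_sqrt ?ltW// div1r.
have p3 : tau `^ (3 / 2) = Num.sqrt tau ^+ 3.
  have -> : (3 / 2 : R) = 1 / 2 * 3%:R by rewrite mulrC div1r.
  by rewrite powRrM p1 powR_mulrn// sqrtr_ge0.
move: poly_condition => /=; rewrite p1 p3 => /lt_le_trans; apply.
rewrite le_eqVlt; apply/orP; left; apply/eqP.
have sE : s = Num.sqrt sigma * Num.sqrt tau * opnorm L.
  by rewrite /s sqrtrM// ltW.
have sgE : sigma = Num.sqrt sigma ^+ 2 by rewrite sqr_sqrtr// ltW.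
rewrite /h /b /g /r sE.
move: (Num.sqrt tau) (Num.sqrt sigma) (opnorm L) st0 stE sgE => t q l t0 <- ->.
field; exact: lt0r_neq0.
Qed.

Lemma solutions_inclusion w : Z w -> A w.1 (- C w.1 - Ls w.2) /\ B (L w.1) w.2.
Proof.
move=> [[x [a Aa [_ -> <-]]] [_ -> ax] Bw]; split=> //.
suff -> : - C w.1 - Ls w.2 = a by [].
by rewrite -opprD; apply/esym/subr0_eq; rewrite opprK addrA.
Qed.

(** With [x = p - w.1] and [u = q - w.2], the values of [A] differ by [y.1 - Ls u] and the arguments
    of [B] by [y.2 + L x], so the skew terms cancel in the sum. The [rho] terms involve [y.1 - Ls u]
    and [Ls u], which add up to [y.1]; the [mu] terms involve [- L x] and [y.2 + L x], which add up
    to [y.2]. Parallel sums apply to both pairs. *)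
Lemma monotone_gap (w : H * G) (z p : H) (v q : G) (y : H * G) : Z w ->
  A p (tau^-1 *: (z - p) - C z - Ls v) ->
  B (sigma^-1 *: (v - q) + L (2 *: p - z)) q ->
  y = P (z - p, v - q) - (C z - C w.1, 0) ->
  nuA * '[p - w.1, p - w.1] + nuB * '[q - w.2, q - w.2] +
  rho * ('[y.1, y.1] + sigma / tau * '[y.2, y.2]) <=
  '[p - w.1, y.1] + '[q - w.2, y.2].
Proof.
move=> Zw Ap Bq ->; rewrite /P /precond /=; set y1 := _ - (C z - C w.1).
set y2 := _ - 0.
have := B_semimonotone (ex_intro2 _ _ w Zw erefl) Bq.
have := A_semimonotone (ex_intro2 _ _ w Zw erefl) Ap.
have -> : tau^-1 *: (z - p) - C z - Ls v - (- C w.1 - Ls w.2) =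
    y1 - Ls (q - w.2).
  rewrite /y1 !(adjointB Ls_adjoint).
  by apply: inner_inj => a; rewrite !innerE; ring.
have -> : sigma^-1 *: (v - q) + L (2 *: p - z) - L w.1 = y2 + L (p - w.1).
  rewrite /y2 subr0 !linearB [L (2 *: p)]linearZ /=.
  by apply: inner_inj => a; rewrite !innerE; ring.
move: y1 y2 => y1 y2; move: (p - w.1) (q - w.2) => x u.
have [_ rho_par mu_par] := rho_hatP tau sigma rho_ge0 mu_ge0 rho_eq0 mu_eq0.
have parA := parallel_sum_le (y1 - Ls u) (Ls u) rho_ge0 rho_eq0 rho_le0 rho_par.
have st0 : 0 < sigma / tau by rewrite divr_gt0.
have parB : rho * (sigma / tau) * '[y2, y2] <=
    muA * '[L x, L x] + muB * '[y2 + L x, y2 + L x].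
  have := @parallel_sum_le _ _ _ _ (rho * (sigma / tau)) (- L x) (y2 + L x)
    mu_ge0 mu_eq0.
  rewrite (addrC (- L x)) addrK innerNl innerNr opprK; apply.
    by rewrite pmulr_lle0.
  by move=> /mu_par; rewrite -ler_pdivlMr// invf_div [leRHS]mulrC.
move: parA parB; rewrite subrK.
rewrite !innerE -!(Ls_adjoint x) (innerC u (L (Ls u))) (Ls_adjoint (Ls u)).
rewrite (innerC (Ls u) y1) (innerC (L x) y2) (innerC u y2).
lra.
Qed.


(** Expanding the energy of the old error minus [theta *: D] produces the gap of [monotone_gap], a
    cocoercivity term, and the cross term ['[z - p, c]], which [discriminant_lower_bound]
    absorbs. *)
Lemma descent (w : H * G) (z p : H) (v q : G) : Z w ->
  A p (tau^-1 *: (z - p) - C z - Ls v) ->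
  B (sigma^-1 *: (v - q) + L (2 *: p - z)) q ->
  En ((1 - theta) *: (z, v) + theta *: (p, q) - w) +
    theta * eps * En (z - p, v - q) +
    2 * theta * (nuA * '[p - w.1, p - w.1] + nuB * '[q - w.2, q - w.2]) <=
  En ((z, v) - w).
Proof.
move=> Zw Ap Bq; set D := (z - p, v - q).
pose y := P D - (C z - C w.1, 0).
have gap := monotone_gap Zw Ap Bq (erefl y).
have res := residual_le L_bounded Ls_adjoint tau0 sigma0 s_lt1 (erefl y).
set c := C z - C w.1 in y gap res.
have coc := C_cocoercive z w.1; rewrite norm_inner -/c in coc.
have -> : (1 - theta) *: (z, v) + theta *: (p, q) - w =
    ((z, v) - w) - theta *: D.
  by congr pair; rewrite /= /D; apply: inner_inj => a; rewrite !innerE; ring.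
rewrite /En energyB// energyZ//.
have -> : dsum_inner (theta *: D) (precond L Ls tau sigma ((z, v) - w)) =
    theta * ('[p - w.1, y.1] + '[q - w.2, y.2] + '[z - w.1, c] - '[z - p, c] +
             energy L Ls tau sigma D).
  rewrite /energy dsum_innerC precond_sym// precondZ// /y /P.
  move: (precond _ _ _ _ D) => PD.
  rewrite /dsum_inner /D /= !subr0.
  by rewrite !innerE; ring.
set N := energy L Ls tau sigma D in res *.
have N0 : 0 <= N by exact: energy_ge0.
pose gam := '[c, c] / g.
have gam0 : 0 <= gam by rewrite divr_ge0 ?inner_ge0// ltW.
have xNg : '[z - p, c] ^+ 2 <= N * gam.
  apply: le_trans (cauchy_schwarz _ _) _.
  rewrite /gam mulrA ler_pdivlMr// mulrAC ler_wpM2r ?inner_ge0// mulrC.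
  exact: (energy_ge1 L_bounded Ls_adjoint tau0 sigma0 D).
have disc := discriminant_lower_bound (2 - theta - 2 * r) h b_gt0 N0 gam0 xNg.
have ccE : '[c, c] = g * gam by rewrite /gam mulrC divfK// gt_eqF.
(* [rho / tau] is nonpositive, so multiplying by it turns the upper bound on the residual into a
   lower bound on the gap. *)
have resr : - r * (N - 2 * '[z - p, c] + gam) <=
    rho * ('[y.1, y.1] + sigma / tau * '[y.2, y.2]).
  have rt : rho / tau <= 0 by rewrite pmulr_lle0 ?invr_gt0.
  have := ler_wnM2l rt res; rewrite -/N -/g -/gam.
  have -> : rho / tau * ((1 + s) * (N - 2 * '[D.1, c] + gam)) =
    - r * (N - 2 * '[z - p, c] + gam) by rewrite /r /D /=; ring.
  move=> /le_trans; apply; rewrite le_eqVlt; apply/orP; left; apply/eqP.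
  by field; exact: lt0r_neq0.
have th : 0 <= 2 * theta by rewrite mulr_ge0// ltW.
have total : (2 - theta) * N + 2 * (nuA * '[p - w.1, p - w.1] +
    nuB * '[q - w.2, q - w.2]) + eps * N - (2 - theta) * N <=
  (2 - theta) * N + 2 * ('[p - w.1, y.1] + '[q - w.2, y.2] +
    '[z - w.1, c] - '[z - p, c]).
  move: disc coc; rewrite ccE -/eps; move: gap resr; rewrite /b /h; lra.
have := ler_wpM2l (ltW theta0) total.
lra.
Qed.

(** A solution [w'] is a fixed point of the iteration, so [descent] from [w'] towards [w] forces the
    [nuA] and [nuB] terms to vanish. *)
Lemma solutions_unique w w' : 0 < nuA -> 0 < nuB -> Z w -> Z w' -> w = w'.
Proof.
move=> nA nB Zw Zw'; have [Aw Bw] := solutions_inclusion Zw'.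
have := @descent w w'.1 w'.1 w'.2 w'.2 Zw.
rewrite !subrr !scaler0 sub0r add0r scaler_nat mulr2n addrK.
move=> /(_ Aw Bw); rewrite -scalerDl subrK scale1r.
rewrite -addrA gerDl => D0.
have [D1 D2] : '[w'.1 - w.1, w'.1 - w.1] <= 0 /\ '[w'.2 - w.2, w'.2 - w.2] <= 0.
  have i1 := inner_ge0 (w'.1 - w.1); have i2 := inner_ge0 (w'.2 - w.2).
  have e0 : 0 <= theta * eps * En (0, 0).
    by rewrite !mulr_ge0 ?(ltW theta0) ?(ltW eps_gt0)//; exact: energy_ge0.
  have : 2 * theta * (nuA * '[w'.1 - w.1, w'.1 - w.1] +
      nuB * '[w'.2 - w.2, w'.2 - w.2]) <= 0.
    by apply: le_trans D0; rewrite lerDr.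
  rewrite pmulr_rle0 ?mulr_gt0// => D.
  split.
  - by rewrite -(pmulr_rle0 _ nA); apply: le_trans D; rewrite lerDl mulr_ge0.
  - by rewrite -(pmulr_rle0 _ nB); apply: le_trans D; rewrite lerDr mulr_ge0.
apply/esym/subr0_eq; congr pair; apply/inner_eq0/eqP.
- by rewrite eq_le D1 inner_ge0.
- by rewrite eq_le D2 inner_ge0.
Qed.

(** * Convergence of the iterates *)

Variables (z p : nat -> H) (v q : nat -> G).
Hypothesis p_incl : forall n,
  A (p n.+1) (tau^-1 *: (z n - p n.+1) - C (z n) - Ls (v n)).
Hypothesis q_incl : forall n,
  B (sigma^-1 *: (v n - q n.+1) + L (2 *: p n.+1 - z n)) (q n.+1).
Hypothesis zv_def : forall n,
  (z n.+1, v n.+1) = (1 - theta) *: (z n, v n) + theta *: (p n.+1, q n.+1).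

Let dist w n := En ((z n, v n) - w).
Let delta n := (z n - p n.+1, v n - q n.+1).
Let g' := (1 - s ^+ 2) / sigma.

Let g'_gt0 : 0 < g'.
Proof. by rewrite divr_gt0// subr_gt0 expr_lt1. Qed.

Let energy_pos w : 0 <= En w.
Proof. exact: energy_ge0. Qed.

Let energy_g w : g * '[w.1, w.1] <= En w.
Proof. exact: energy_ge1. Qed.

Let energy_g' w : g' * '[w.2, w.2] <= En w.
Proof. exact: energy_ge2. Qed.

Lemma iterates_descent w n : Z w ->
  dist w n.+1 + theta * eps * En (delta n) +
    2 * theta * (nuA * '[p n.+1 - w.1, p n.+1 - w.1] +
                 nuB * '[q n.+1 - w.2, q n.+1 - w.2]) <= dist w n.
Proof. by move=> Zw; rewrite /dist zv_def; exact: descent. Qed.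

Lemma iterates_fejer w n : Z w ->
  dist w n.+1 + theta * eps * En (delta n) <= dist w n.
Proof.
move=> Zw; apply: le_trans (iterates_descent n Zw); rewrite lerDl.
by rewrite mulr_ge0 ?addr_ge0 ?mulr_ge0 ?inner_ge0 ?(ltW theta0).
Qed.

Let te_ge0 n : 0 <= theta * eps * En (delta n).
Proof. by rewrite !mulr_ge0 ?(ltW theta0) ?(ltW eps_gt0). Qed.

Lemma dist_nonincreasing w : Z w -> nonincreasing_seq (dist w).
Proof.
move=> Zw; apply/nonincreasing_seqP => n.
by apply: le_trans (iterates_fejer n Zw); rewrite lerDl.
Qed.

Lemma dist_cvg w : Z w -> cvg (dist w n @[n --> \oo]).
Proof.
move=> Zw; apply: nonincreasing_is_cvgn; first exact: dist_nonincreasing.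
by exists 0 => _ [n _ <-]; exact: energy_pos.
Qed.

(** The step energy is at most a constant times the difference of consecutive terms of the
    convergent sequence [dist w]. *)
Lemma energy_delta_cvg0 w : Z w -> En (delta n) @[n --> \oo] --> 0.
Proof.
move=> Zw; have /cvg_ex[l dl] := dist_cvg Zw.
have te : 0 < theta * eps by rewrite mulr_gt0.
have ub : (theta * eps)^-1 * (dist w n - dist w n.+1) @[n --> \oo] --> 0.
  have -> : 0 = (theta * eps)^-1 * (l - l) by rewrite subrr mulr0.
  apply: cvgMr; apply: cvgB => //.
  by rewrite (@cvg_shiftS _ (dist w)).
apply: squeeze_cvgr ub; last exact: cvg_cst.
apply: filterE => n; rewrite energy_pos /= ler_pdivlMl//.
by have := iterates_fejer n Zw; lra.
Qed.

Hypothesis graph_closed : weak_strong_closed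
  (graph (add_op (bigA L Ls A B) (fun_op (bigC C)))).

Lemma cocoercive_lipschitz x y : beta * `|C x - C y| <= `|x - y|.
Proof.
have [->|c0] := eqVneq (C x - C y) 0; first by rewrite normr0 mulr0.
have nc0 : 0 < `|C x - C y| by rewrite normr_gt0.
rewrite -(ler_pM2r nc0) -mulrA -expr2.
apply: le_trans (C_cocoercive x y) _; apply: le_trans (ler_norm _) _.
exact: norm_inner_le.
Qed.

(** Steps vanish strongly, so [(p, q)] has the weak limit of [(z, v)], while the inclusions place it
    in the graph with a right-hand side tending strongly to 0. Closedness of the graph then yields
    the inclusion at [l]. *)
Lemma cluster_solution (phi : nat -> nat) (l : H * G) : Z !=set0 ->
  (forall k, (k <= phi k)%N) ->
  weak_cvg (fun k => (z (phi k), v (phi k))) l -> Z l.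
Proof.
move=> [w Zw] phik zvl.
have phioo : phi @ \oo --> \oo.
  move=> S [N _ NS]; exists N => //= k Nk; apply: NS => /=.
  exact: leq_trans (phik k).
have N0 := energy_delta_cvg0 Zw.
have d0 : (z n - p n.+1) @[n --> \oo] --> 0.
  by apply: cvg0_of_sqr g_gt0 _ N0 => n; exact: (energy_g (delta n)).
have e0 : (v n - q n.+1) @[n --> \oo] --> 0.
  by apply: cvg0_of_sqr g'_gt0 _ N0 => n; exact: (energy_g' (delta n)).
have Ls0 : Ls (v n - q n.+1) @[n --> \oo] --> 0.
  exact: cvg0_of_norm_le (fun n => adjoint_norm_le L_bounded Ls_adjoint _) e0.
have L0 : L (z n - p n.+1) @[n --> \oo] --> 0.
  exact: cvg0_of_norm_le (fun n => opnormP L_bounded _) d0.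
have C0 : (C (z n) - C (p n.+1)) @[n --> \oo] --> 0.
  apply: (cvg0_of_norm_le (K := beta^-1)) d0 => n.
  by rewrite ler_pdivlMl//; exact: cocoercive_lipschitz.
pose x k := (p (phi k).+1, q (phi k).+1).
(* This is [P (delta n)] corrected by [C (z n) - C (p n.+1)]: the algorithm evaluates [C] at [z n],
   the graph needs it at [p n.+1]. *)
pose u n :=
  (tau^-1 *: (z n - p n.+1) - Ls (v n - q n.+1) - (C (z n) - C (p n.+1)),
   sigma^-1 *: (v n - q n.+1) - L (z n - p n.+1)).
have : graph (add_op (bigA L Ls A B) (fun_op (bigC C))) (l, 0).
  apply: (graph_closed (x := x) (u := u \o phi)).
  - move=> k; set n := phi k.
    exists (tau^-1 *: (z n - p n.+1) - C (z n) - Ls (v n) + Ls (q n.+1),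
      sigma^-1 *: (v n - q n.+1) + L (2 *: p n.+1 - z n) - L (p n.+1)).
      split => /=.
      - by eexists; [exact: p_incl|].
      - by eexists; [exact: q_incl|].
    exists (C (p n.+1), 0) => //=; rewrite /u /=; congr pair => /=.
    - rewrite !(adjointB Ls_adjoint).
      by apply: inner_inj => a; rewrite !innerE; ring.
    - rewrite !linearB [L (2 *: _)]linearZ /=.
      by rewrite addr0; apply: inner_inj => a; rewrite !innerE; ring.
  - move=> a.
    have -> : (fun k => dsum_inner (x k) a) = (fun k =>
        dsum_inner (z (phi k), v (phi k)) a - dsum_inner (delta (phi k)) a).
      apply/funext => k; rewrite /dsum_inner /x /delta /= !innerE; ring.
    rewrite -[X in _ --> X]subr0; apply: cvgB; first exact: zvl.
    apply: (cvg_comp phi (fun n => dsum_inner (delta n) a) phioo).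
    have -> : 0 = '[0, a.1] + '[0, a.2] by rewrite !inner0l addr0.
    by apply: cvgD; apply: cvg_inner.
  - apply: (cvg_comp phi u phioo).
    apply: cvg_pair => /=.
    + have -> : (0 : H) = tau^-1 *: 0 - 0 - 0 by rewrite scaler0 !subr0.
      apply: cvgB => //; apply: cvgB => //; exact: cvgZr.
    + have -> : (0 : G) = sigma^-1 *: 0 - 0 by rewrite scaler0 subr0.
      apply: cvgB => //; exact: cvgZr.
move=> [[x1 x2] [/= [a' Aa' <-] [b' Bb' <-]] [_ -> []]] /= eq1 eq2.
split.
- exists (a' + C l.1); first by exists a' => //; exists (C l.1).
  exists (Ls l.2) => //; rewrite -eq1.
  by apply: inner_inj => x'; rewrite !innerE; ring.
- suff -> : L l.1 = b' by [].
  by apply/esym/subr0_eq; rewrite -eq2 addr0.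
Qed.

Lemma iterates_weak_cvg : Z !=set0 ->
  exists2 w, Z w & weak_cvg (fun n => (z n, v n)) w.
Proof.
move=> Z0; have [w Zw] := Z0.
have bounded (E : hilbertType R) (x : nat -> E) (l : E) (k : R) : 0 < k ->
    (forall n, k * '[x n - l, x n - l] <= dist w n) ->
    exists M, forall n, `|x n| <= M.
  move=> k0 xd; exists (`|l| + Num.sqrt (dist w 0%N / k)) => n.
  rewrite -[x n](subrK l) addrC (le_trans (ler_normD _ _))// lerD2l.
  rewrite -(@ler_pXn2r _ 2)// ?nnegrE ?sqrtr_ge0// norm_inner sqr_sqrtr.
    rewrite ler_pdivlMr// mulrC (le_trans (xd n))//.
    exact: (dist_nonincreasing Zw (leq0n n)).
  exact: divr_ge0 (energy_pos _) (ltW k0).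
have [M1 zM] := bounded H z w.1 g g_gt0
  (fun n => energy_g ((z n, v n) - w)).
have [M2 vM] := bounded G v w.2 g' g'_gt0
  (fun n => energy_g' ((z n, v n) - w)).
apply: (@opial _ _ _ P Z _ (Num.max M1 M2)).
- exact: precondB.
- exact: precond_sym.
- exact: energy_eq0.
- by move=> n; rewrite le_max zM.
- by move=> n; rewrite le_max vM orbT.
- exact: dist_cvg.
- by move=> phi l phik; exact: cluster_solution.
Qed.

(** The error is the sum of [wp], controlled by the [nuA] and [nuB] terms of the descent, and of
    [delta n], controlled by the [eps] term; a fixed fraction of [dist w n] is thus lost at each
    step. *)
Lemma iterates_linear_cvg w : 0 < nuA -> 0 < nuB -> Z w ->
  R_linear_cvg (fun n => (z n, v n)) w.
Proof.
move=> nA nB Zw.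
pose K := (1 + s) * (tau^-1 + sigma^-1).
have K0 : 0 < K.
  by apply: mulr_gt0; [rewrite ltr_pwDl|rewrite addr_gt0// invr_gt0].
pose nu := Num.min nuA nuB.
have nu0 : 0 < nu by rewrite lt_min nA.
(* The bounds in turn keep [1 - k] positive, charge [2 k En wp] to the [nu] terms, and charge
   [2 k En (delta n)] to the [eps] term. *)
pose k := Num.min 2^-1 (Num.min (theta * nu / K) (theta * eps / 2)).
have k0 : 0 < k.
  by rewrite !lt_min invr_gt0 ltr0n /= !divr_gt0// !mulr_gt0.
have k1 : k <= 2^-1 by rewrite ge_min lexx.
have kK : k * K <= theta * nu by rewrite -ler_pdivlMr// !ge_min lexx orbT.
have ke : k * 2 <= theta * eps by rewrite -ler_pdivlMr// !ge_min lexx !orbT.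
have step n : dist w n.+1 <= (1 - k) * dist w n.
  have := iterates_descent n Zw.
  set D := nuA * _ + nuB * _.
  set wp := (p n.+1, q n.+1) - w.
  have S0 : 0 <= '[wp.1, wp.1] + '[wp.2, wp.2] by rewrite addr_ge0 ?inner_ge0.
  have nuD : nu * ('[wp.1, wp.1] + '[wp.2, wp.2]) <= D.
    by rewrite mulrDr lerD// ler_wpM2r ?inner_ge0// ge_min lexx ?orbT.
  have wpK : En wp <= K * ('[wp.1, wp.1] + '[wp.2, wp.2]).
    apply: le_trans (energy_le L_bounded Ls_adjoint tau0 sigma0 wp) _.
    rewrite -/s /K -mulrA ler_wpM2l ?addr_ge0//.
    have := inner_ge0 wp.1; have := inner_ge0 wp.2.
    have : 0 < tau^-1 by rewrite invr_gt0.
    have : 0 < sigma^-1 by rewrite invr_gt0.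
    nra.
  have par : dist w n <= 2 * En wp + 2 * En (delta n).
    have -> : dist w n = En (wp + delta n).
      by rewrite /dist; congr En; congr pair; rewrite /wp /delta /=;
        apply: inner_inj => a; rewrite !innerE; ring.
    by rewrite -mulrDr; exact: energyD_le.
  have e0 := energy_pos (delta n).
  have := ler_wpM2l (ltW k0) par.
  have := ler_wpM2l (ltW k0) wpK.
  have := ler_wpM2r S0 kK.
  have := ler_wpM2l (ltW theta0) nuD.
  have := ler_wpM2r e0 ke.
  lra.
have geo n : dist w n <= dist w 0%N * (1 - k) ^+ n.
  elim: n => [|n IH]; first by rewrite expr0 mulr1.
  apply: le_trans (step n) _; rewrite exprS mulrCA ler_wpM2l//.
  by rewrite subr_ge0 (le_trans k1)// invf_le1// ler1n.
have k10 : 0 < 1 - k by lra.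
have gg0 : 0 <= g^-1 + g'^-1 by rewrite addr_ge0 ?invr_ge0 ?ltW.
(* The energy dominates [g] and [g'] times the squared norms of the two components; the roots appear
   because [dist] is a squared distance. *)
exists (Num.sqrt ((g^-1 + g'^-1) * dist w 0%N)), (Num.sqrt (1 - k)); split.
- exact: sqrtr_ge0.
- by rewrite sqrtr_gt0.
- by rewrite -[ltRHS]sqrtr1 ltr_sqrt//; lra.
- move=> n; rewrite -(@ler_pXn2r _ 2)// ?nnegrE ?mulr_ge0 ?exprn_ge0
    ?sqrtr_ge0//.
  rewrite /dsum_norm exprMn -exprM mulnC exprM !sqr_sqrtr ?(ltW k10)//;
    last 2 first.
  - exact: mulr_ge0 gg0 (energy_pos _).
  - by rewrite addr_ge0 ?inner_ge0.
  rewrite -mulrA; apply: le_trans (ler_wpM2l _ (geo n)) => //.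
  by rewrite mulrDl /dsum_inner lerD// ler_pdivlMl.
Qed.

End Algorithm.

(** * Resolvent steps as inclusions, and the conclusion *)

Lemma resolvent_inclusion (R : realType) (E : hilbertType R) (F : E -> set E)
    (t : R) (x y : E) : t != 0 -> resolvent (scale_op t F) x = [set y] ->
  F y (t^-1 *: (x - y)).
Proof.
move=> t0 xy; have : resolvent (scale_op t F) x y by rewrite xy.
move=> [_ -> [_ [a Fa <-] <-]].
by rewrite /= addrC addKr scalerA mulVf// scale1r.
Qed.

Theorem proposition4p12 (R : realType) (H G : hilbertType R)
  (L : {linear H -> G}) (Ls : G -> H)
  (A : H -> set H) (B : G -> set G) (C : H -> H) (beta : R)
  (muA muB rhoA rhoB nuA nuB : R) (OmegaA OmegaB : set R)
  (tau sigma theta : R)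
  (z p : nat -> H) (v q : nat -> G)
  (L_bounded : bounded_fun_norm L)
  (Ls_adjoint : is_adjoint L Ls)
  (beta_gt0 : 0 < beta)
  (C_cocoercive : cocoercive beta C)
  (Z_nonempty : solutions L Ls A B C !=set0)
  (nuA_ge0 : 0 <= nuA) (nuB_ge0 : 0 <= nuB)
  (rho_ge0 : 0 <= rhoA + rhoB) (mu_ge0 : 0 <= muA + muB)
  (rho_eq0 : rhoA + rhoB = 0 -> rhoA = 0 /\ rhoB = 0)
  (mu_eq0 : muA + muB = 0 -> muA = 0 /\ muB = 0)
  (A_semimonotone :
    semimonotone_on (fun x => nuA *: x + muA *: Ls (L x)) (fun u => rhoA *: u)
      [set (w.1, - C w.1 - Ls w.2) | w in solutions L Ls A B C] A)
  (B_semimonotone :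
    semimonotone_on (fun x => muB *: x) (fun u => nuB *: u + rhoB *: L (Ls u))
      [set (L w.1, w.2) | w in solutions L Ls A B C] B)
  (OmegaA_nonempty : OmegaA !=set0) (OmegaB_nonempty : OmegaB !=set0)
  (OmegaA_gt0 : OmegaA `<=` [set t | 0 < t])
  (OmegaB_gt0 : OmegaB `<=` [set s | 0 < s])
  (resolvents_ok : forall t s, OmegaA t -> OmegaB s ->
    single_valued_full_domain (resolvent (scale_op t A)) /\
    single_valued_full_domain (resolvent (scale_op s (inv_op B))))
  (graph_closed : weak_strong_closed
    (graph (add_op (bigA L Ls A B) (fun_op (bigC C)))))
  (tau_Omega : OmegaA tau) (sigma_Omega : OmegaB sigma)
  (theta_gt0 : 0 < theta) (theta_lt2 : theta < 2)
  (step_condition :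
    Num.sqrt (sigma * tau) * opnorm L
      < (beta + rho_hat muA muB rhoA rhoB tau sigma) / beta)
  (poly_condition :
    let rho := rho_hat muA muB rhoA rhoB tau sigma in
    let l := opnorm L in
    0 < - (1 + 2 * beta * sigma * l ^+ 2 * (2 - theta)) * tau ^+ 2
        - 2 * rho * Num.sqrt sigma * l
            * (2 * beta * sigma * l ^+ 2 + theta) * tau `^ (3 / 2)
        + 2 * (beta * (2 - theta) - rho * (2 * beta * sigma * l ^+ 2 + theta))
            * tau
        + 4 * beta * rho * Num.sqrt sigma * l * tau `^ (1 / 2)
        + 4 * beta * rho)
  (p_def : forall n,
    resolvent (scale_op tau A) (z n - tau *: (C (z n) + Ls (v n)))
      = [set p n.+1])
  (q_def : forall n,
    resolvent (scale_op sigma (inv_op B))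
        (v n + sigma *: L (2 *: p n.+1 - z n))
      = [set q n.+1])
  (zv_def : forall n,
    (z n.+1, v n.+1)
      = (1 - theta) *: (z n, v n) + theta *: (p n.+1, q n.+1)) :
  (exists2 w, solutions L Ls A B C w & weak_cvg (fun n => (z n, v n)) w) /\
  (0 < nuA -> 0 < nuB ->
    exists2 w, solutions L Ls A B C = [set w] &
      R_linear_cvg (fun n => (z n, v n)) w).
Proof.
have tau0 := OmegaA_gt0 _ tau_Omega; have sigma0 := OmegaB_gt0 _ sigma_Omega.
have p_incl n : A (p n.+1) (tau^-1 *: (z n - p n.+1) - C (z n) - Ls (v n)).
  have := resolvent_inclusion (lt0r_neq0 tau0) (p_def n).
  rewrite addrAC scalerBr scalerA mulVf ?lt0r_neq0// scale1r.
  by rewrite opprD addrA.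
have q_incl n :
    B (sigma^-1 *: (v n - q n.+1) + L (2 *: p n.+1 - z n)) (q n.+1).
  have := resolvent_inclusion (lt0r_neq0 sigma0) (q_def n).
  by rewrite addrAC scalerDr scalerA mulVf ?lt0r_neq0// scale1r.
split.
  exact: (iterates_weak_cvg L_bounded Ls_adjoint beta_gt0 C_cocoercive nuA_ge0
    nuB_ge0 rho_ge0 mu_ge0 rho_eq0 mu_eq0 A_semimonotone B_semimonotone tau0
    sigma0 theta_gt0 step_condition poly_condition p_incl q_incl zv_def
    graph_closed Z_nonempty).
move=> nA nB; have [w Zw] := Z_nonempty; exists w.
  apply/seteqP; split=> [w' Zw'|_ ->//] /=.
  exact: (solutions_unique L_bounded Ls_adjoint beta_gt0 C_cocoercive
    nuA_ge0 nuB_ge0 rho_ge0 mu_ge0 rho_eq0 mu_eq0 A_semimonotone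
    B_semimonotone tau0 sigma0 theta_gt0 step_condition poly_condition nA nB
    Zw' Zw).
exact: (iterates_linear_cvg L_bounded Ls_adjoint beta_gt0 C_cocoercive
  rho_ge0 mu_ge0 rho_eq0 mu_eq0 A_semimonotone B_semimonotone tau0
  sigma0 theta_gt0 step_condition poly_condition p_incl q_incl zv_def nA nB Zw).
Qed.
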